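(* Let $G$ be a plane graph with edge weights, symmetric with respect to reflection across a line $\ell$ (weights invariant under the reflection), and denote its vertices on $\ell$, from left to right, by $a_1,\dots,a_k$. Let $E=\{e_1,\dots,e_s\}$ be a set of $s\le k$ pairwise disjoint edges of $G$, each incident to exactly one of $a_1,\dots,a_k$, and orient each $e_i$ away from $\ell$ (from its endpoint on $\ell$ to its other endpoint); for an oriented edge $e$, let $e'$ be its reflection across $\ell$ with the induced orientation. Let $v$ be a vertex of $G$ lying on $\ell$ and on the unbounded face, not incident to any edge of $E$. For $I\subseteq[s]$ let $\mathcal{T}^v_{E,I}(G)$ be the set of spanning trees $T$ of $G$ rooted at $v$ that contain the oriented edge $e_i$ for all $i\in I$ and the oriented edge $e'_i$ for all $i\in[s]\setminus I$ (i.e., the unique edge of $T$ exiting the endpoint of $e_i$ on $\ell$ is $e_i$ for $i\in I$ and $e'_i$ for $i\notin I$). Then the sum of the weights of the spanning trees in $\mathcal{T}^v_{E,I}(G)$ is the same for all $I\subseteq[s]$.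
   Context: Graphs have no loops or multiple edges. A spanning tree rooted at $v$ has each edge oriented toward $v$, so each vertex other than $v$ has exactly one outgoing edge. The weight of a spanning tree is the product of the weights of its edges. *)

(* Defs.v *)
From mathcomp Require Import all_boot all_order all_algebra.
From mathcomp Require Import all_classical all_reals all_analysis.
Import Order.TTheory GRing.Theory Num.Theory.
Import numFieldNormedType.Exports.

Set Implicit Arguments.
Unset Strict Implicit.
Unset Printing Implicit Defensive.

Local Open Scope classical_set_scope.
Local Open Scope ring_scope.

Definition dot (R : realType) (x y : 'rV[R]_2) : R := (x *m y^T) 0 0.

(* A line comes with a direction; "from left to right" along the line means
   in this direction (for a horizontal line, take it to point right). *)
Record line (R : realType) := Line {
  origin : 'rV[R]_2;
  direction : 'rV[R]_2;
  direction_neq0 : direction != 0 }.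

Definition on_line (R : realType) (l : line R) (p : 'rV[R]_2) : Prop :=
  exists t : R, p = origin l + t *: direction l.

Definition coordinate (R : realType) (l : line R) (p : 'rV[R]_2) : R :=
  dot (p - origin l) (direction l) / dot (direction l) (direction l).

(* [origin l + coordinate l p *: direction l] is the orthogonal projection of
   [p] on [l], hence the midpoint of [p] and its mirror image. *)
Definition reflection (R : realType) (l : line R) (p : 'rV[R]_2) : 'rV[R]_2 :=
  2%:R *: (origin l + coordinate l p *: direction l) - p.

Definition arc_between (R : realType) (p q : 'rV[R]_2) (A : set 'rV[R]_2) :
    Prop :=
  exists g : R -> 'rV[R]_2,
    [/\ {within `[0, 1], continuous g},
        {in `[0, 1] &, injective g},
        g 0 = p,
        g 1 = q &
        A = g @` `[0, 1]].

(* Finite plane graphs without loops or multiple edges: an edge is identified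
   with its set of endpoints, and [curve e] is the arc that draws it (only
   meaningful for [e \in edges]).  The interior of an edge, i.e. its arc
   without the endpoints, contains no vertex and no point of another edge. *)
Record plane_graph (R : realType) := PlaneGraph {
  vertex : finType;
  pos : vertex -> 'rV[R]_2;
  edges : {set {set vertex}};
  curve : {set vertex} -> set 'rV[R]_2;
  pos_inj : injective pos;
  edge_card : forall e, e \in edges -> #|e| = 2%N;
  curve_arc : forall x y, [set x; y]%SET \in edges ->
    arc_between (pos x) (pos y) (curve [set x; y]%SET);
  curve_vertex : forall e x, e \in edges ->
    ~ (curve e `\` pos @` [set` e]) (pos x);
  curve_disjoint : forall e f, e \in edges -> f \in edges -> e != f ->
    (curve e `\` pos @` [set` e]) `&` curve f = set0 }.

Section Graph.
Context {R : realType} (G : plane_graph R).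
Implicit Types (l : line R) (x y v : vertex G) (e f : {set vertex G})
  (a : vertex G * vertex G) (T : {set {set vertex G}}).

Definition drawing : set 'rV[R]_2 :=
  range (@pos R G) `|` \bigcup_(e in [set` edges G]) curve e.

Definition face (F : set 'rV[R]_2) : Prop :=
  exists2 p, (~` drawing) p & F = connected_component (~` drawing) p.

Definition on_unbounded_face v : Prop :=
  exists F, [/\ face F, ~ bounded_set F & closure F (pos v)].

Definition symmetric_across l : Prop :=
  (forall x, exists y, pos y = reflection l (pos x)) /\
  (forall e, e \in edges G ->
     exists2 f, f \in edges G & curve f = reflection l @` curve e).

Definition invariant_weight l (K : Type) (w : {set vertex G} -> K) : Prop :=
  forall e f, e \in edges G -> f \in edges G ->
    curve f = reflection l @` curve e -> w f = w e.

(* The default value [x] is never used when [G] is symmetric across [l]. *)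
Definition mirror l x : vertex G :=
  odflt x [pick y | pos y == reflection l (pos x)].

(* The oriented edge from [x] to [y] is the pair [(x, y)]. *)
Definition ends a : {set vertex G} := [set a.1; a.2]%SET.

Definition mirror_edge l a : vertex G * vertex G := (mirror l a.1, mirror l a.2).

Definition adjacent T : rel (vertex G) := [rel x y | [set x; y]%SET \in T].

Definition spanning_tree T : Prop :=
  [/\ T \subset edges G,
      forall x y, connect (adjacent T) x y &
      forall c : seq (vertex G), (2 < size c)%N -> ~ ucycle (adjacent T) c].

(* In the tree [T] rooted at [v], the edge joining [a.1] and [a.2] is oriented
   from [a.1] to [a.2]: it is the first edge of the path of [T] that leads
   from [a.1] to [v]. *)
Definition contains_oriented v T a : Prop :=
  exists p : seq (vertex G),
    [/\ path (adjacent T) a.1 (a.2 :: p), uniq [:: a.1, a.2 & p] &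
        last a.2 p = v].

Definition tree_family l v (s : nat) (e : 'I_s -> vertex G * vertex G)
    (I : {set 'I_s}) T : Prop :=
  [/\ spanning_tree T,
      forall i, i \in I -> contains_oriented v T (e i) &
      forall i, i \notin I -> contains_oriented v T (mirror_edge l (e i))].

Definition tree_weight (K : comNzRingType) (w : {set vertex G} -> K) T : K :=
  \prod_(f in T) w f.

End Graph.

(* Main.v *)
(* The reflection acts on the vertices as an involutive weighted automorphism
   fixing the root, and this is the only geometric input: planarity plays no
   role. By the matrix-tree theorem the sum for [I] is the determinant of the
   Laplacian in which the row of the endpoint of [e i] on the line only keeps
   [e i] or its mirror image. Modulo antisymmetric row vectors, these rows do
   not depend on [I]; and the differences of mirror rows off the line already
   give as many antisymmetric rows as the dimension of the space of
   antisymmetric row vectors. Hence the matrix is block triangular with diagonal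
   blocks that do not depend on [I]. *)
Require Import Defs.
From mathcomp Require Import all_boot all_order all_algebra.
From mathcomp Require Import all_classical all_reals all_analysis.
From mathcomp Require Import fingroup perm ring.
Import Order.TTheory GRing.Theory Num.Theory.
Import numFieldNormedType.Exports.

Set Implicit Arguments.
Unset Strict Implicit.
Unset Printing Implicit Defensive.

Local Open Scope ring_scope.

(** * Determinants over a commutative ring *)

(** A permutation without zero factors lowers [d] at every index it moves; since it preserves the
    sum of [d], it is the identity. *)
Lemma det_of_rank (K : comNzRingType) n (A : 'M[K]_n) (d : 'I_n -> nat) :
  (forall i, A i i = 1) ->
  (forall i j, i != j -> A i j != 0 -> (d j < d i)%N) -> \det A = 1.
Proof.
move=> A1 Ad; rewrite /determinant (bigD1 (1%g : 'S_n)) //=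
  [X in _ + X]big1 => [|s s_neq1].
  by rewrite odd_perm1 mul1r addr0 big1 // => i _; rewrite perm1 A1.
have [[i Ai0]|/forallNP Aneq0] := pselect (exists i, A i (s i) = 0).
  by rewrite (bigD1 i) //= Ai0 mul0r mulr0.
have ds_lt i : s i != i -> (d (s i) < d i)%N.
  by move=> si; apply: Ad; [rewrite eq_sym|exact/eqP/Aneq0].
have ds i : (d (s i) <= d i ?= iff (s i == i))%N.
  split; have [->|si] := eqVneq (s i) i; rewrite ?eqxx //.
    exact/ltnW/ds_lt.
  by rewrite ltn_eqF ?ds_lt.
have [_] := @leqif_sum _ predT _ _ _ (fun i _ => ds i).
rewrite [X in _ == X](reindex_inj (h := s) perm_inj) /= eqxx => /esym/forallP/= s1.
by case/eqP: s_neq1; apply/permP => i; rewrite perm1; exact/eqP/s1.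
Qed.

(** Multiplying by the adjugate shows that [\det A] annihilates [u]. Since [K] may have zero
    divisors, an entry equal to 1 is asked for rather than a nonzero one. *)
Lemma det_eq0_kernel (K : comNzRingType) n (A : 'M[K]_n) (u : 'cV_n) i :
  A *m u = 0 -> u i 0 = 1 -> \det A = 0.
Proof.
move=> Au ui; have := congr1 (mulmx (\adj A)) Au.
rewrite mulmxA mul_adj_mx mulmx0 mul_scalar_mx => /matrixP/(_ i 0).
by rewrite !mxE ui mulr1.
Qed.

(** [1 - N] is inverse to [1 + N]. This serves to cancel the determinants of row and column
    operations. *)
Lemma det_unipotent (K : comNzRingType) n (N : 'M[K]_n) :
  N *m N = 0 -> exists u, u * \det (1%:M + N) = 1.
Proof.
move=> N0; exists (\det (1%:M - N)); rewrite -det_mulmx.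
by rewrite mulmxDr mulmx1 mulmxBl N0 mul1mx subr0 subrK det1.
Qed.

(* Adding column [s j] to column [j] when [s j < j], and subtracting row [s i]
   from row [i] when [i < s i], makes both matrices block triangular with the
   same diagonal blocks. *)
Lemma det_eq_mod_antisymmetric (K : comNzRingType) n (s : 'I_n -> 'I_n)
    (A B : 'M[K]_n) :
  involutive s ->
  (forall i, s i != i -> forall j, A (s i) (s j) = A i j) ->
  (forall i, s i != i -> forall j, A i j = B i j) ->
  (forall i j, s i = i -> s j = j -> A i j = B i j) ->
  (forall i j, s i = i -> s j != j -> A i j + A i (s j) = B i j + B i (s j)) ->
  \det A = \det B.
Proof.
move=> sK Asym ABoff ABfix ABsum.
pose N := \matrix_(i, j) ((s j < j)%N && (i == s j))%:R : 'M[K]_n.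
pose Q := \matrix_(i, j) - ((i < s i)%N && (j == s i))%:R : 'M[K]_n.
(* A nonzero [N i k] requires [s k < k], whereas a nonzero [N k j] forces [k = s j < j = s k]. *)
have N2 : N *m N = 0.
  apply/matrixP => i j; rewrite !mxE big1 // => k _; rewrite !mxE.
  have [/andP[skk _]|_] := boolP ((s k < k)%N && _); last by rewrite mul0r.
  have [/andP[sjj /eqP kE]|_] := boolP ((s j < j)%N && _); last by rewrite mulr0.
  by move: skk sjj; rewrite kE sK ltnNge => /negbTE; case: ltngtP.
have Q2 : Q *m Q = 0.
  apply/matrixP => i j; rewrite !mxE big1 // => k _; rewrite !mxE.
  have [/andP[skk /eqP kE]|_] := boolP ((i < s i)%N && _); last by rewrite oppr0 mul0r.
  have [/andP[sjj _]|_] := boolP ((k < s k)%N && _); last by rewrite oppr0 mulr0.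
  by move: skk sjj; rewrite kE sK; case: ltngtP.
have mulN (C : 'M[K]_n) i j : (C *m (1%:M + N)) i j =
    C i j + (if (s j < j)%N then C i (s j) else 0).
  rewrite mulmxDr mulmx1 !mxE; congr (_ + _).
  rewrite (bigD1 (s j)) //= big1 ?addr0 => [|k kj]; rewrite !mxE.
    by rewrite eqxx andbT; case: ifP; rewrite ?mulr1 ?mulr0.
  by rewrite (negbTE kj) andbF mulr0.
have mulQ (C : 'M[K]_n) i j : ((1%:M + Q) *m C) i j =
    C i j - (if (i < s i)%N then C (s i) j else 0).
  rewrite mulmxDl mul1mx !mxE; congr (_ + _).
  rewrite (bigD1 (s i)) //= big1 ?addr0 => [|k kj]; rewrite !mxE.
    by rewrite eqxx andbT; case: ifP; rewrite ?mulN1r ?oppr0 ?mul0r.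
  by rewrite (negbTE kj) andbF oppr0 mul0r.
pose red C := (1%:M + Q) *m (C *m (1%:M + N)).
suff redE : \det (red A) = \det (red B).
  have [u uN] := det_unipotent N2; have [t tQ] := det_unipotent Q2.
  have detE C : \det C = t * u * \det (red C).
    rewrite !det_mulmx.
    transitivity (t * \det (1%:M + Q) * (u * \det (1%:M + N)) * \det C).
      by rewrite tQ uN !mul1r.
    by ring.
  by rewrite (detE A) (detE B) redE.
pose neg (i : 'I_n) := (i < s i)%N.
have neg_s i : neg i -> s i != i by rewrite /neg; case: eqP => // ->; rewrite ltnn.
(* For [neg i], row [i] becomes the difference of rows [i] and [s i]. It is antisymmetric, so it
   vanishes on the columns outside [neg], which are sums over orbits of [s]. *)
have redN (C : 'M[K]_n) i j : (forall i, s i != i -> forall j, C (s i) (s j) = C i j) ->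
    neg i -> ~~ neg j -> red C i j = 0.
  move=> Csym ni; rewrite /red mulQ !mulN; rewrite /neg in ni *; rewrite ni.
  have si : s i != i by exact: neg_s.
  have ssi : s (s i) != s i by rewrite sK eq_sym.
  case: ltngtP => // [sj|/val_inj sj] _.
    rewrite -[C (s i) j]Csym // -[C (s i) (s j)]Csym // !sK; ring.
  by rewrite -[C (s i) j]Csym // sK -sj addr0 subrr.
have Bsym i : s i != i -> forall j, B (s i) (s j) = B i j.
  by move=> si j; rewrite -!ABoff ?Asym // sK eq_sym.
rewrite /determinant; apply: eq_bigr => p _.
have [[i /andP[ni npi]]|/forallNP pneg] :=
    pselect (exists i, neg i && ~~ neg (p i)).
  have prod0 (C : 'M[K]_n) :
      (forall i, s i != i -> forall j, C (s i) (s j) = C i j) ->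
      \prod_k red C k (p k) = 0.
    by move=> Csym; rewrite (bigD1 i) //= redN // mul0r.
  by rewrite !prod0.
congr (_ * _); apply: eq_bigr => i _.
(* A remaining permutation maps [neg] into itself, hence by finiteness also its complement, so only
   the two diagonal blocks contribute. *)
have p_neg : {homo p : i / i \in [set i | neg i]%SET}.
  move=> j; rewrite !inE => nj.
  by case: (boolP (neg (p j))) (pneg j); rewrite ?nj // => ? [].
have [ni|ni] := boolP (neg i).
  have ABi j k : s j != j -> A j k = B j k by move=> ?; apply: ABoff.
  have si := neg_s _ ni.
  have ssi : s (s i) != s i by rewrite sK eq_sym.
  by rewrite /red !mulQ !mulN !ABi.
have np : ~~ neg (p i).
  apply: contra ni => np.
  have pE : p @: [set i | neg i]%SET = [set i | neg i]%SET.
    apply/eqP; rewrite eqEcard card_imset ?leqnn ?andbT; last exact: perm_inj.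
    by apply/fintype.subsetP => _ /imsetP[j jn ->]; exact: p_neg.
  have : p i \in p @: [set i | neg i]%SET by rewrite pE inE.
  by case/imsetP => j; rewrite inE => nj /perm_inj ->.
move: (p i) np ni => j; rewrite /neg => nj ni.
rewrite /red !mulQ !mulN (negbTE ni) !subr0; move: nj.
have [si|si] := eqVneq (s i) i; last by rewrite !ABoff.
case: ltngtP => // [sj|/val_inj sj] _.
  by apply: ABsum => //; apply: contraTneq sj => ->; rewrite ltnn.
by rewrite !addr0 ABfix.
Qed.

(** * Rooted spanning trees encoded by parent functions *)

Section RootedFunctions.
Variables (V : finType) (v : V).
Implicit Types (g : {ffun V -> V}) (x y z : V).

(** The loop at [v] makes the parent map of a tree total; the second condition excludes any other
    cycle. *)
Definition rooted g := (g v == v) && [forall x, fconnect g x v].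

(** The rank of a vertex is the number of iterations of [g] needed to reach [v]. *)
Lemma rooted_rank g : rooted g ->
  exists d : V -> nat, forall x, x != v -> (d (g x) < d x)%N.
Proof.
move=> /andP[_ /forallP gv].
have ex x : exists n, iter n g x == v.
  by exists (findex g x v); rewrite iter_findex.
exists (fun x => ex_minn (ex x)) => x xv.
case: ex_minnP => m _ mmin; case: ex_minnP => -[|n] gxv _.
  by rewrite (negbTE xv) in gxv.
by rewrite ltnS mmin // -iterSr.
Qed.

Lemma rank_rooted g (d : V -> nat) : g v = v ->
  (forall x, x != v -> (d (g x) < d x)%N) -> rooted g.
Proof.
move=> gv dg; rewrite /rooted gv eqxx; apply/forallP => x.
have [n] := ubnP (d x); elim: n => // n IHn in x * => dx.
have [->|xv] := eqVneq x v; first exact: connect0.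
apply: connect_trans (fconnect1 g x) _; apply: IHn.
by apply: leq_trans (dg _ xv) _.
Qed.

Definition tree_set g : {set {set V}} := [set [set x; g x] | x in [set~ v]].

Local Notation adj T := [rel x y | [set x; y]%SET \in T].

Lemma set2_eqP (x y z t : V) :
  [set x; y]%SET = [set z; t]%SET -> (x = z /\ y = t) \/ (x = t /\ y = z).
Proof.
move=> /setP E; have := E x; have := E y; have := E z; have := E t.
rewrite !inE !eqxx ?orbT /= => /orP tE /orP zE /esym/orP yE /esym/orP xE.
case: xE yE tE zE => /eqP xE [] /eqP yE [] /eqP tE [] /eqP zE;
  by [left; split; congruence|right; split; congruence].
Qed.

Lemma adj_tree_set g x y : [set x; y]%SET \in tree_set g ->
  (x != v /\ g x = y) \/ (y != v /\ g y = x).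
Proof.
case/imsetP => z; rewrite !inE => zv /set2_eqP[] [-> ->]; by [left|right].
Qed.

Lemma tree_set_adj g x : x != v -> [set x; g x]%SET \in tree_set g.
Proof. by move=> xv; apply/imsetP; exists x; rewrite ?inE. Qed.

(** Two vertices giving the same edge would be parents of each other, against the rank. This turns
    products over edges into products over the vertices other than [v]. *)
Lemma rooted_edge_inj g : rooted g ->
  {in [set~ v] &, injective (fun x => [set x; g x]%SET)}.
Proof.
move=> /rooted_rank[d dg] x y; rewrite !inE => xv yv /set2_eqP[[]//|[xE yE]].
by have := dg _ xv; rewrite yE => /(ltn_trans (dg _ yv)); rewrite -xE ltnn.
Qed.

Lemma adjC (T : {set {set V}}) : symmetric (adj T).
Proof. by move=> x y; rewrite /= finset.setUC. Qed.

Lemma tree_set_connect g x : rooted g -> connect (adj (tree_set g)) x v.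
Proof.
move=> /rooted_rank[d dg].
have [n] := ubnP (d x); elim: n => // n IHn in x * => dx.
have [->|xv] := eqVneq x v; first exact: connect0.
apply: connect_trans (IHn (g x) _); last exact: leq_trans (dg _ xv) _.
by apply: connect1; exact: tree_set_adj.
Qed.

Lemma tree_set_connected g x y : rooted g -> connect (adj (tree_set g)) x y.
Proof.
move=> gr; apply: connect_trans (tree_set_connect x gr) _.
by rewrite (sym_connect_sym (@adjC _)) tree_set_connect.
Qed.

(* Both neighbours on the cycle of a vertex of maximal rank would be its
   image. *)
Lemma tree_set_acyclic g (c : seq V) : rooted g -> (2 < size c)%N ->
  ~ ucycle (adj (tree_set g)) c.
Proof.
move=> /rooted_rank[d dg] c2 /andP[cyc unq].
have [x0 x0c] : exists x0, x0 \in c.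
  by case: c c2 {cyc unq} => // x0 *; exists x0; rewrite inE eqxx.
pose x := [arg max_(x > x0 in c) d x].
have [xc xmax] : x \in c /\ forall y, y \in c -> (d y <= d x)%N.
  by rewrite /x; case: arg_maxnP.
have up y : y \in c -> adj (tree_set g) x y -> g x = y.
  move=> yc /adj_tree_set[[]//|[yv gy]].
  by have := xmax _ yc; rewrite leqNgt -gy dg.
have [i p rot_c] := rot_to xc.
have szp : (1 < size p)%N by rewrite -ltnS -[(size p).+1]/(size (x :: p)) -rot_c size_rot.
move: cyc unq (mem_rot i c); rewrite -(rot_cycle i) -(rot_uniq i) rot_c.
(* The neighbours of [x] on the cycle are [y] and [last z p], distinct because the cycle has at
   least three vertices. *)
case: p szp {rot_c} => [|y [|z p]] //= _; rewrite rcons_path /=.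
move=> /and3P[xy _ /andP[_ lx]] /and3P[_ yn _] mem_c.
have gy : g x = y by apply: up xy; rewrite -mem_c !inE eqxx orbT.
have gl : g x = last z p.
  apply: up; last by rewrite /= finset.setUC.
  by rewrite -mem_c !inE; have := mem_last z p; rewrite inE => ->; rewrite !orbT.
by case/negP: yn; rewrite -gy gl mem_last.
Qed.

(** Having come from the parent [x] of [y], a path without repetition can only go on to children,
    and the root is never a child. *)
Lemma descending_path g x y (p : seq V) : g y = x -> y != v ->
  path (adj (tree_set g)) y p -> uniq [:: x, y & p] -> last y p != v.
Proof.
elim: p x y => //= z p IHp x y gy yv /andP[yz zp] /and3P[xn yn unq].
case/adj_tree_set: yz => [[_ gyz]|[zv gz]].
  by move: xn; rewrite -gy gyz !inE eqxx orbT.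
by apply: (IHp y z) => //; apply/andP.
Qed.

Lemma first_edge g x y (p : seq V) : path (adj (tree_set g)) x (y :: p) ->
  uniq [:: x, y & p] -> last y p = v -> g x = y.
Proof.
move=> /= /andP[xy yp] unq lastv.
case/adj_tree_set: xy => [[]//|[yv gy]].
by have := descending_path gy yv yp unq; rewrite lastv eqxx.
Qed.

Lemma path_to_root g x : rooted g -> x != v ->
  exists p : seq V, [/\ path (adj (tree_set g)) x (g x :: p),
    uniq [:: x, g x & p] & last (g x) p = v].
Proof.
move=> gr xv; have [p xp lastp] := connectP (tree_set_connect x gr).
move: lastp; case/shortenP: xp => -[|y q] xq unq _ lastq.
  by rewrite lastq eqxx in xv.
by rewrite (first_edge xq unq) //; exists q.
Qed.

(** The parent of [x] can be read off the tree: it is the second vertex of a simple path from [x] to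
    [v]. *)
Lemma tree_set_inj : {in [pred g | rooted g] &, injective tree_set}.
Proof.
move=> g h gr hr E; apply/ffunP => x.
have [->|xv] := eqVneq x v.
  by case/andP: gr hr => /eqP-> _ /andP[/eqP->].
have [p [xp unq lastp]] := path_to_root gr xv.
by rewrite E in xp; rewrite (first_edge xp unq lastp).
Qed.

(** Each vertex other than [v] takes as parent a neighbour in [T] strictly closer to [v]. *)
Lemma tree_set_surj (T : {set {set V}}) :
  (forall x, [set x; x]%SET \notin T) ->
  (forall f, f \in T -> exists x y, f = [set x; y]%SET) ->
  (forall x y, connect (adj T) x y) ->
  (forall c : seq V, (2 < size c)%N -> ~ ucycle (adj T) c) ->
  exists2 g, rooted g & T = tree_set g.
Proof.
move=> Tloop Tpair Tconn Tacyc.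
(* [ex_minn] needs a boolean predicate; the minimum [d] is the distance to [v] in [T]. *)
have ex x : exists n, `[< exists p, [/\ path (adj T) x p, last x p = v & size p = n] >].
  have /connectP[p xp lastp] := Tconn x v.
  by exists (size p); apply/asboolP; exists p.
pose d x := ex_minn (ex x).
have closer x : x != v -> exists y, ([set x; y]%SET \in T) && (d y < d x)%N.
  move=> xv; rewrite {2}/d; case: ex_minnP => m /asboolP[[|y p] [/= xp lastp szp] _].
    by rewrite lastp eqxx in xv.
  case/andP: xp => xy yp; exists y; rewrite xy -szp ltnS /d.
  by case: ex_minnP => k _; apply; apply/asboolP; exists p.
(* By [closer], the default value [x] is never taken. *)
pose g := [ffun x => if x == v then v else
  odflt x [pick y | ([set x; y]%SET \in T) && (d y < d x)%N]].
have gP x : x != v -> ([set x; g x]%SET \in T) && (d (g x) < d x)%N.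
  move=> xv; rewrite /g ffunE (negbTE xv); case: pickP => //= none.
  by have [y yP] := closer x xv; have := none y; rewrite /= yP.
have gr : rooted g.
  by apply: (@rank_rooted _ d) => [|x /gP/andP[]//]; rewrite ffunE eqxx.
exists g => //; apply/eqP; rewrite finset.eqEsubset; apply/andP; split; last first.
  by apply/fintype.subsetP => f /imsetP[x]; rewrite !inE => /gP/andP[xT _] ->.
have sub : subrel (adj (tree_set g)) (adj T).
  move=> x y /= /imsetP[z]; rewrite !inE => /gP/andP[zT _] ->; exact: zT.
(* An edge of [T] outside the tree would close the tree path between its endpoints into a cycle of
   [T]. That path has at least two steps, since the edge is neither a loop nor in the tree. *)
apply/fintype.subsetP => f fT; have [x [y fE]] := Tpair f fT.
rewrite {f}fE in fT *; apply/negPn/negP => xyN.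
have [p xp lastp] := connectP (tree_set_connected x y gr).
move: lastp; case/shortenP: xp => q xq unq _ lastq.
apply: (Tacyc (x :: q)).
  case: q xq unq lastq => [|z [|t q]] //=.
    by move=> _ _ yx; move: fT; rewrite yx (negbTE (Tloop x)).
  by rewrite andbT => xz _ yz; rewrite yz xz in xyN.
rewrite /ucycle unq andbT /= rcons_path (sub_path sub xq) /= -lastq.
by rewrite finset.setUC.
Qed.

End RootedFunctions.

(** * The matrix-tree theorem and the redirection of edges *)

Section RootedLaplacian.
Variables (K : comNzRingType) (V : finType) (v : V).
Implicit Types (c : V -> V -> K) (g : {ffun V -> V}) (x y z : V).

(** At the root only the diagonal term is kept, which replaces deleting the row and the column of
    [v]. *)
Definition outgoing_row x z y : K := (x == y)%:R - ((x != v) && (z == y))%:R.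

Definition rooted_laplacian c : 'M[K]_#|V| := \matrix_(i, j)
  \sum_z c (enum_val i) z * outgoing_row (enum_val i) z (enum_val j).

Lemma rooted_laplacianE c i j : rooted_laplacian c i j =
  (\sum_z c (enum_val i) z) *+ (i == j) -
  c (enum_val i) (enum_val j) *+ (enum_val i != v).
Proof.
rewrite mxE -mulr_natr mulr_suml.
under eq_bigr do rewrite /outgoing_row (inj_eq enum_val_inj) mulrBr.
rewrite big_split /=; congr (_ + _); rewrite sumrN; congr (- _).
rewrite (bigD1 (enum_val j)) //= eqxx andbT big1 => [|z /negbTE->].
  by rewrite addr0 mulr_natr.
by rewrite andbF mulr0.
Qed.

(** One term of the multilinear expansion of the Laplacian: each vertex chooses a single
    successor. *)
Definition functional_matrix g : 'M[K]_#|V| := \matrix_(i, j)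
  outgoing_row (enum_val i) (g (enum_val i)) (enum_val j).

Lemma fconnect_step g x : x != v -> fconnect g (g x) v = fconnect g x v.
Proof.
move=> xv; apply/idP/idP => [|gxv]; first exact: connect_trans (fconnect1 g x).
have := iter_findex gxv; case: (findex _ _ _) => [/= /eqP|n].
  by rewrite (negbTE xv).
by rewrite iterSr => <-; exact: fconnect_iter.
Qed.

(* If [g] is not rooted, the indicator of the vertices that never reach [v]
   is in the kernel. *)
Lemma det_functional_matrix g : g v = v ->
  \det (functional_matrix g) = (rooted v g)%:R.
Proof.
move=> gv; have [gr|gr] := boolP (rooted v g).
  have [d dg] := rooted_rank gr.
  apply: (@det_of_rank _ _ _ (d \o enum_val)) => [i|i j ij]; rewrite !mxE /outgoing_row.
    have [iv|iv] := eqVneq (enum_val i) v; rewrite eqxx ?subr0 //=.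
    case: eqP => [gi|]; last by rewrite subr0.
    by have := dg _ iv; rewrite gi ltnn.
  rewrite (inj_eq enum_val_inj) (negbTE ij) sub0r oppr_eq0.
  have [iv|iv] /= := eqVneq (enum_val i) v; first by rewrite eqxx.
  by case: (g _ =P _) => [<- _|_]; [exact: dg|rewrite eqxx].
move: gr; rewrite /rooted gv eqxx /= => /forallPn[x xv].
pose u : 'cV[K]_#|V| := \col_i (~~ fconnect g (enum_val i) v)%:R.
apply: (@det_eq0_kernel _ _ _ u (enum_rank x)); last by rewrite mxE enum_rankK xv.
apply/matrixP => i j; rewrite !mxE.
under eq_bigr do rewrite !mxE /outgoing_row (inj_eq enum_val_inj) mulrBl.
rewrite big_split sumrN /= (bigD1 i) //= eqxx mul1r big1 => [|k ki]; last first.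
  by rewrite eq_sym (negbTE ki) mul0r.
rewrite addr0; have [->|iv] := eqVneq (enum_val i) v.
  by rewrite connect0 sub0r big1 ?oppr0 // => k _; rewrite mul0r.
rewrite (bigD1 (enum_rank (g (enum_val i)))) //= enum_rankK eqxx mul1r big1.
  by rewrite fconnect_step // addr0 subrr.
move=> k kg; case: eqP => [gk|]; last by rewrite mul0r.
by case/eqP: kg; rewrite gk enum_valK.
Qed.

(* The matrix-tree theorem, by expanding every row of the Laplacian. *)
Lemma det_rooted_laplacian c : (forall z, z != v -> c v z = 0) ->
  \det (rooted_laplacian c) =
  \sum_(g : {ffun V -> V} | rooted v g) \prod_x c x (g x).
Proof.
move=> cv; transitivity (\sum_(g : {ffun V -> V})
    (\prod_x c x (g x)) * \det (functional_matrix g)).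
  under [RHS]eq_bigr do rewrite big_distrr /=.
  rewrite exchange_big /=; apply: eq_bigr => s _.
  under [RHS]eq_bigr do rewrite mulrCA.
  rewrite -big_distrr /=; congr (_ * _).
  pose F x z := c x z * outgoing_row x z (enum_val (s (enum_rank x))).
  transitivity (\prod_x \sum_z F x z).
    rewrite (reindex (@enum_rank V)) /=; last exact/onW_bij/enum_rank_bij.
    by apply: eq_bigr => x _; rewrite mxE enum_rankK.
  rewrite bigA_distr_bigA /=; apply: eq_bigr => g _.
  rewrite big_split /=; congr (_ * _).
  rewrite [RHS](reindex (@enum_rank V)) /=; last exact/onW_bij/enum_rank_bij.
  by apply: eq_bigr => x _; rewrite mxE enum_rankK.
rewrite [RHS]big_mkcond; apply: eq_bigr => g _.
have [gv|gv] := eqVneq (g v) v.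
  by rewrite det_functional_matrix //; case: ifP; rewrite ?mulr1 ?mulr0.
(* A function that moves [v] is not rooted, and its product contains the zero factor [c v (g v)]. *)
rewrite /rooted (negbTE gv) /= (bigD1 v) //= cv //.
by rewrite !mul0r.
Qed.

(* Redirecting the edges that leave the fixed vertices of the automorphism
   [s] changes the corresponding rows of the Laplacian by antisymmetric
   vectors. *)
Lemma sum_rooted_redirect (s : V -> V) c c' :
  involutive s -> s v = v -> (forall z, z != v -> c v z = 0) ->
  (forall x, s x != x -> forall z, c (s x) (s z) = c x z) ->
  (forall x, (forall z, c' x z = c x z) \/
     (s x = x /\ forall z, c' x z = c x (s z))) ->
  \sum_(g : {ffun V -> V} | rooted v g) \prod_x c x (g x) =
  \sum_(g : {ffun V -> V} | rooted v g) \prod_x c' x (g x).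
Proof.
move=> sK sv cv csym c'P.
have s_eq x y : (s x == s y) = (x == y) by exact/inj_eq/inv_inj.
have c'v z : z != v -> c' v z = 0.
  have [->|[_ ->]] := c'P v; first exact: cv.
  by rewrite -s_eq sv => /cv.
have sum_s (f : V -> K) : \sum_z f (s z) = \sum_z f z.
  by rewrite [RHS](reindex_inj (inv_inj sK)).
have sumE x : \sum_z c' x z = \sum_z c x z.
  have [|[_]] := c'P x => c'x; first exact: eq_bigr.
  by rewrite -[RHS]sum_s; exact: eq_bigr.
rewrite -!det_rooted_laplacian //.
pose t (i : 'I_#|V|) := enum_rank (s (enum_val i)).
have t_fix i : (t i == i) = (s (enum_val i) == enum_val i).
  by rewrite /t -(inj_eq enum_val_inj) enum_rankK.
apply: (@det_eq_mod_antisymmetric _ _ t) => [i|i ti j|i ti j|i j ti tj|i j ti tj].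
- by rewrite /t enum_rankK sK enum_valK.
- rewrite t_fix in ti.
  rewrite !rooted_laplacianE !enum_rankK csym // -[\sum_z _]sum_s.
  under eq_bigr do rewrite csym //.
  by rewrite (inj_eq enum_rank_inj) s_eq (inj_eq enum_val_inj) -{1}sv s_eq.
- rewrite t_fix in ti; rewrite !rooted_laplacianE sumE.
  by have [->|[si]] := c'P (enum_val i); last by rewrite si eqxx in ti.
- move/eqP: tj; rewrite t_fix => /eqP sj.
  rewrite !rooted_laplacianE sumE.
  by have [->|[_ ->]] := c'P (enum_val i); rewrite ?sj.
(* Redirection exchanges the entries at [j] and [t j], which preserves their sum. *)
- rewrite !rooted_laplacianE sumE enum_rankK.
  have [E|[_ E]] := c'P (enum_val i); rewrite !E // sK; ring.
Qed.

End RootedLaplacian.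

(** * Reflection across a line *)

Section Reflection.
Variables (R : realType) (l : line R).
Implicit Types (p q : 'rV[R]_2).

Lemma dotE p q : dot p q = \sum_j p 0 j * q 0 j.
Proof. by rewrite /dot mxE; apply: eq_bigr => j _; rewrite mxE. Qed.

Lemma dot_self_neq0 p : p != 0 -> dot p p != 0.
Proof.
apply: contraNneq; rewrite dotE => p0; apply/eqP/rowP => j; rewrite mxE.
have sqr_ge0 i : true -> 0 <= p 0 i * p 0 i by rewrite -expr2 sqr_ge0.
by have /eqP := psumr_eq0P sqr_ge0 p0 (i := j) isT; rewrite mulf_eq0 orbb => /eqP.
Qed.

Lemma dotDZl (t : R) p q r : dot (t *: p + q) r = t * dot p r + dot q r.
Proof. by rewrite /dot mulmxDl -scalemxAl !mxE. Qed.

Lemma coordinate_on_line (t : R) : coordinate l (origin l + t *: direction l) = t.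
Proof.
rewrite /coordinate addrC addKr -[_ *: _]addr0 dotDZl {2}/dot mul0mx mxE addr0.
by rewrite mulfK // dot_self_neq0 // direction_neq0.
Qed.

Lemma reflection_on_line p : on_line l p -> reflection l p = p.
Proof.
by case=> t ->; rewrite /reflection coordinate_on_line scaler_nat mulr2n addrK.
Qed.

(** A point and its image have the same coordinate along [l], so both reflections use the same
    midpoint. *)
Lemma reflectionK : involutive (reflection l).
Proof.
move=> p; have coordE : coordinate l (reflection l p) = coordinate l p.
  rewrite {1}/coordinate /reflection.
  set t := coordinate l p.
  have -> : 2%:R *: (origin l + t *: direction l) - p - origin l =
      (2%:R * t) *: direction l + (-1) *: (p - origin l) + 0.
    by apply/rowP => j; rewrite !mxE; ring.
  rewrite -addrA dotDZl addr0 -[_ *: (p - _)]addr0 dotDZl {3}/dot mul0mx mxE addr0.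
  have d0 := dot_self_neq0 (direction_neq0 l).
  by rewrite /t /coordinate; field.
by rewrite {1}/reflection coordE /reflection opprB addrCA subrr addr0.
Qed.

End Reflection.

(** * The reflection as an automorphism of the weighted graph *)

Section Mirror.
Variables (R : realType) (G : plane_graph R) (l : line R).
Hypothesis hsym : symmetric_across G l.
Implicit Types (x y : vertex G) (e f : {set vertex G}).

Lemma pos_mirror x : pos (mirror l x) = reflection l (pos x).
Proof.
rewrite /mirror; case: pickP => [y /eqP //|none].
by have [y yE] := hsym.1 x; have := none y; rewrite yE eqxx.
Qed.

Lemma mirrorK : involutive (@mirror R G l).
Proof. by move=> x; apply: (@pos_inj R G); rewrite !pos_mirror reflectionK. Qed.

Lemma mirror_on_line x : on_line l (pos x) -> mirror l x = x.
Proof. by move=> xl; apply: (@pos_inj R G); rewrite pos_mirror reflection_on_line. Qed.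

Lemma edge_neq x y : [set x; y]%SET \in edges G -> x != y.
Proof. by move/edge_card; rewrite cards2; case: eqVneq. Qed.

Lemma endpoint_of_curve e x : e \in edges G -> curve e (pos x) -> x \in e.
Proof.
move=> eG ex; have := curve_vertex (x := x) eG; apply: contra_notT => xe.
by split=> // -[y /= ye /pos_inj yx]; rewrite -yx ye in xe.
Qed.

(** Symmetry is assumed for curves only. The endpoints of [f] are recovered because its curve passes
    through both mirrored vertices and an edge meets no vertex except its endpoints. *)
Lemma mirror_edge_curve x y : [set x; y]%SET \in edges G ->
  exists2 f, f \in edges G & f = [set mirror l x; mirror l y]%SET /\
    curve f = (reflection l @` curve [set x; y]%SET)%classic.
Proof.
move=> xyG; have [f fG fE] := hsym.2 _ xyG; exists f => //; split=> //.
have [g [_ _ g0 g1 gE]] := curve_arc xyG.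
have in01 (t : R) : 0 <= t <= 1 -> (`[0, 1]%classic : set R) t.
  by rewrite /= in_itv.
have xf : mirror l x \in f.
  apply: endpoint_of_curve => //; rewrite fE pos_mirror; exists (pos x) => //.
  by rewrite gE -g0; exists 0 => //; apply: in01; rewrite lexx ler01.
have yf : mirror l y \in f.
  apply: endpoint_of_curve => //; rewrite fE pos_mirror; exists (pos y) => //.
  by rewrite gE -g1; exists 1 => //; apply: in01; rewrite lexx ler01.
apply/esym/eqP; rewrite eqEcard finset.subUset !finset.sub1set xf yf /=.
rewrite (edge_card fG) cards2 (inj_eq (inv_inj mirrorK)).
by rewrite (edge_neq xyG).
Qed.

Lemma mirror_edge_in x y :
  ([set mirror l x; mirror l y]%SET \in edges G) = ([set x; y]%SET \in edges G).
Proof.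
by apply/idP/idP => /mirror_edge_curve[f fG [fE _]]; move: fG;
  rewrite fE ?mirrorK.
Qed.

Lemma weight_mirror (K : Type) (w : {set vertex G} -> K) x y :
  invariant_weight l w -> [set x; y]%SET \in edges G ->
  w [set mirror l x; mirror l y]%SET = w [set x; y]%SET.
Proof. by move=> hw xyG; have [f fG [<- fE]] := mirror_edge_curve xyG; exact: hw. Qed.

End Mirror.

(** * Constrained spanning trees as weighted parent functions *)

Section SpanningTrees.
Variables (R : realType) (G : plane_graph R) (v : vertex G).
Implicit Types (x y : vertex G) (g : {ffun vertex G -> vertex G}).

Lemma spanning_tree_set g : rooted v g ->
  (forall x, x != v -> [set x; g x]%SET \in edges G) ->
  spanning_tree (tree_set v g : {set {set vertex G}}).
Proof.
move=> gr gG; split=> [|x y|c c2].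
- by apply/fintype.subsetP => f /imsetP[x]; rewrite !inE => /gG xG ->.
- exact: tree_set_connected.
- exact: tree_set_acyclic.
Qed.

Lemma spanning_treeP (T : {set {set vertex G}}) : spanning_tree T ->
  exists2 g, rooted v g & T = tree_set v g.
Proof.
case=> TG Tconn Tacyc; apply: tree_set_surj => // [x|f /(fintype.subsetP TG) fG].
  by apply/negP => /(fintype.subsetP TG)/edge_neq; rewrite eqxx.
have /eqP/cards2P[x [y [_ fE]]] := edge_card fG.
  by exists x, y.
Qed.

Lemma contains_oriented_tree_set g (a : vertex G * vertex G) :
  rooted v g -> a.1 != v ->
  contains_oriented v (tree_set v g : {set {set vertex G}}) a <-> g a.1 = a.2.
Proof.
move=> gr av; rewrite /contains_oriented; split=> [[p [ap unq lastp]]|<-].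
  exact: first_edge ap unq lastp.
by have [p [? ? ?]] := path_to_root gr av; exists p.
Qed.

Variables (K : comNzRingType) (w : {set vertex G} -> K).
Variables (s : nat) (b : 'I_s -> vertex G * vertex G).

(** Forbidden choices get weight 0 and the loop at the root gets weight 1, so that a sum over all
    rooted functions selects the required trees. *)
Definition constrained_weight x y : K :=
  if x == v then (y == v)%:R
  else if ([set x; y]%SET \in edges G) &&
          [forall i, ((b i).1 == x) ==> ((b i).2 == y)]
  then w [set x; y]%SET else 0.

(** [tree_set] matches the functions of [A] with the trees of the sum; any other rooted function has
    a zero factor. *)
Lemma sum_spanning_trees : (forall i, (b i).1 != v) ->
  \sum_(T : {set {set vertex G}} |
      `[< spanning_tree T /\ forall i, contains_oriented v T (b i) >])
    tree_weight w T =
  \sum_(g : {ffun vertex G -> vertex G} | rooted v g)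
    \prod_x constrained_weight x (g x).
Proof.
move=> bv.
pose A := [set g : {ffun vertex G -> vertex G} | [&& rooted v g,
  [forall x, (x != v) ==> ([set x; g x]%SET \in edges G)] &
  [forall i, g (b i).1 == (b i).2]]]%SET.
have AP g : reflect [/\ rooted v g,
    forall x, x != v -> [set x; g x]%SET \in edges G &
    forall i, g (b i).1 = (b i).2] (g \in A).
  rewrite inE; apply: (iffP and3P) => -[gr gG gb]; split=> //.
  - by move=> x; apply/implyP/(forallP gG).
  - by move=> i; apply/eqP/(forallP gb).
  - by apply/forallP => x; apply/implyP/gG.
  - by apply/forallP => i; apply/eqP.
transitivity (\sum_(T in [set tree_set v g | g in A]%SET) tree_weight w T).
  apply: eq_bigl => T; apply/asboolP/imsetP => [[Ttree Tb]|[g /AP[gr gG gb] ->]].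
    have [g gr TE] := spanning_treeP Ttree; exists g => //; apply/AP; split=> //.
      move=> x xv; have [TG _ _] := Ttree; apply: (fintype.subsetP TG).
      by rewrite TE tree_set_adj.
    by move=> i; apply/(contains_oriented_tree_set gr (bv i)); rewrite -TE.
  split=> [|i]; first exact: spanning_tree_set.
  exact/contains_oriented_tree_set.
rewrite big_imset /=; last first.
  by move=> g h /AP[gr _ _] /AP[hr _ _]; exact: (tree_set_inj (v := v)).
rewrite big_mkcond [RHS]big_mkcond; apply: eq_bigr => g _.
case: ifP => [/AP[gr gG gb]|gA].
  rewrite gr /tree_weight big_imset /=; last exact: rooted_edge_inj.
  rewrite [RHS](bigD1 v) //= {1}/constrained_weight eqxx.
  case/andP: (gr) => -> _; rewrite mul1r.
  apply: eq_big => x; rewrite !inE // => xv.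
  rewrite /constrained_weight (negbTE xv) gG //=.
  by case: forallP => // -[] i; apply/implyP => /eqP <-; rewrite gb.
case: ifP => // gr; move/negbT: gA; rewrite inE gr /= negb_and.
have gv : g v = v by apply/eqP; case/andP: gr.
have zero x : x != v -> ~~ (([set x; g x]%SET \in edges G) &&
    [forall i, ((b i).1 == x) ==> ((b i).2 == g x)]) ->
    0 = \prod_x constrained_weight x (g x).
  move=> xv xN; rewrite (bigD1 x) //= {1}/constrained_weight (negbTE xv).
  by rewrite (negbTE xN) mul0r.
case/orP => /forallPn[].
  move=> x; rewrite negb_imply => /andP[xv xN].
  by apply: (zero x) => //; rewrite negb_and xN.
move=> i gbi; apply: (zero _ (bv i)); rewrite negb_and; apply/orP; right.
by apply/forallPn; exists i; rewrite eqxx /= eq_sym.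
Qed.

End SpanningTrees.

Theorem theorem6p3 (R : realType) (K : comNzRingType)
    (G : plane_graph R) (w : {set vertex G} -> K) (l : line R)
    (hsym : symmetric_across G l) (hw : invariant_weight l w)
    (k : nat) (a : k.-tuple (vertex G))
    (ha : forall x : vertex G, x \in a <-> on_line l (pos x))
    (ha_sorted : forall i j : 'I_k, (i < j)%N ->
       coordinate l (pos (tnth a i)) < coordinate l (pos (tnth a j)))
    (s : nat) (hs : (s <= k)%N) (e : 'I_s -> vertex G * vertex G)
    (he : forall i : 'I_s, ends (e i) \in edges G)
    (he_disj : forall i j : 'I_s, i != j -> [disjoint ends (e i) & ends (e j)])
    (he_one : forall i : 'I_s, #|[set j : 'I_k | tnth a j \in ends (e i)]%SET| = 1%N)
    (he_away : forall i : 'I_s, on_line l (pos (e i).1))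
    (v : vertex G) (hv : on_line l (pos v)) (hv_face : on_unbounded_face v)
    (hvE : forall i : 'I_s, v \notin ends (e i)) :
  forall I J : {set 'I_s},
    \sum_(T : {set {set vertex G}} | `[< tree_family l v e I T >]) tree_weight w T =
    \sum_(T : {set {set vertex G}} | `[< tree_family l v e J T >]) tree_weight w T.
Proof.
move=> I J.
pose b (H : {set 'I_s}) i := if i \in H then e i else mirror_edge l (e i).
have vfix : mirror l v = v by exact: mirror_on_line.
have efix i : mirror l (e i).1 = (e i).1 by exact: mirror_on_line.
have b1 H i : (b H i).1 = (e i).1 by rewrite /b; case: ifP => //= _; exact: efix.
have e1v i : (e i).1 != v.
  by apply: contraNneq (hvE i) => <-; rewrite set21.
have familyE H : \sum_(T : {set {set vertex G}} | `[< tree_family l v e H T >])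
      tree_weight w T =
    \sum_(g : {ffun vertex G -> vertex G} | rooted v g)
      \prod_x constrained_weight v w (b H) x (g x).
  rewrite -sum_spanning_trees => [|i]; last by rewrite b1.
  apply: eq_bigl => T; apply: asbool_equiv_eq; split=> [[Ttree TH TNH]|[Ttree Tb]].
    by split=> // i; rewrite /b; case: ifPn => [/TH|/TNH].
  by split=> // i iH; have := Tb i; rewrite /b; [rewrite iH|rewrite (negbTE iH)].
rewrite !familyE.
have mK := mirrorK hsym; have m_eq := inj_eq (inv_inj mK).
(* Here [c] and [c'] are the constrained weights for [I] and [J]. *)
apply: (@sum_rooted_redirect _ _ _ (mirror l)) => // [z /negbTE zv|x x_moved z|x].
- by rewrite /constrained_weight eqxx zv.
(* A vertex moved by the reflection starts no [e i], so its weights are unconstrained and inherit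
   the invariance of [w]. *)
- have xe i : (e i).1 == x = false.
    by apply: contraNF x_moved => /eqP <-; rewrite efix.
  have mxe i : (e i).1 == mirror l x = false by rewrite -efix m_eq.
  have xv : x == v = false by apply: contraNF x_moved => /eqP ->; rewrite vfix.
  rewrite /constrained_weight -{1}vfix m_eq xv mirror_edge_in //.
  have allT y : y != v -> (forall i, (e i).1 == y = false) -> forall t,
      [forall i, ((b I i).1 == y) ==> ((b I i).2 == t)].
    by move=> _ ye t; apply/forallP => i; rewrite b1 ye.
  rewrite !allT ?xv //; last by rewrite -vfix m_eq xv.
  by rewrite !andbT; case: ifP => // xzG; exact: weight_mirror.
have [->|xv] := eqVneq x v; first by left=> z; rewrite /constrained_weight eqxx.
have [[i /eqP xe]|/forallNP xe] := pselect (exists i, (e i).1 == x); last first.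
  left=> z; rewrite /constrained_weight (negbTE xv).
  have allT H : [forall i, ((b H i).1 == x) ==> ((b H i).2 == z)].
    by apply/forallP => i; rewrite b1; apply/implyP => /xe.
  by rewrite !allT.
(* Disjointness of the edges makes [i] the only constraint at [x]. *)
have ei_inj j : (e j).1 = x -> j = i.
  move=> jx; apply/eqP; apply: contraTT isT => /he_disj/disjoint_setI0/setP/(_ x).
  by rewrite !inE jx xe eqxx.
have onlyE H z : [forall j, ((b H j).1 == x) ==> ((b H j).2 == z)] = ((b H i).2 == z).
  apply/forallP/idP => [/(_ i)|bz j]; first by rewrite b1 xe eqxx.
  by apply/implyP => /eqP; rewrite b1 => /ei_inj ->.
have mx : mirror l x = x by rewrite -xe efix.
rewrite /constrained_weight (negbTE xv).
have [IJ|IJ] := eqVneq (i \in I) (i \in J).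
  by left=> z; rewrite !onlyE /b IJ.
(* When [i] lies in exactly one of [I] and [J], the two prescribed edges at [x] are mirror images of
   each other. *)
right; split=> // z; rewrite !onlyE -{3}mx mirror_edge_in //.
have -> : ((b I i).2 == mirror l z) = ((b J i).2 == z).
  by move: IJ; rewrite /b; do 2 case: ifP => //= _; rewrite -m_eq ?mK.
by case: ifP => // /andP[xzG _]; rewrite -{2}mx weight_mirror.
Qed.
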